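(* The semidefinite program $\mathrm{SDP}_A$ (Anstreicher's QAP relaxation specialized to the traveling salesman problem, defined in the context) has an unbounded integrality gap; that is, $$\sup_{D\in\mathcal{D}} \frac{\mathrm{OPT}_{\mathrm{TSP}}(D)}{\mathrm{OPT}_{\mathrm{SDP}_A}(D)}=+\infty .$$
   Context: TSP: an instance on $n$ vertices is a symmetric matrix $D=(d_{ij})\in\mathbb{R}^{n\times n}$ with $d_{ij}\ge 0$, $d_{ii}=0$ and $d_{ij}\le d_{ik}+d_{kj}$ for all $i,j,k$ (distinct vertices may be at distance $0$). $\mathcal{D}$ is the set of all such matrices, over all $n\ge 3$. $\mathrm{OPT}_{\mathrm{TSP}}(D)$ is the minimum total cost of a Hamiltonian cycle in $K_n$ with edge costs $d_{ij}$. Notation: $I_m$, $J_m$ are the $m\times m$ identity and all-ones matrices; $e^{(n)}\in\mathbb{R}^n$ is the all-ones vector; $\mathbb{S}^{m\times m}$ is the set of real symmetric $m\times m$ matrices; $\otimes$ is the Kronecker product; $\ge 0$ for matrices is entrywise and $\succeq 0$ means positive semidefinite. $C^{(n)}_1$ is the adjacency matrix of the $n$-cycle with edges $\{i,i+1\}$ and $\{n,1\}$. $\mathrm{SDP}_A$: partition $Y\in\mathbb{S}^{n^2\times n^2}$ into $n\times n$ blocks $Y^{(ij)}$, $1\le i,j\le n$. Let $$F=\begin{pmatrix}(e^{(n)})^T\otimes I_n\\ I_n\otimes (e^{(n)})^T\end{pmatrix}.$$ $\mathrm{OPT}_{\mathrm{SDP}_A}(D)$ is the minimum of $\tfrac12\mathrm{trace}\big((D\otimes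 C^{(n)}_1)Y\big)$ over $Y\in\mathbb{S}^{n^2\times n^2}$ with $Y\ge 0$ and (i) $\sum_{i=1}^n Y^{(ii)}=I_n$; (ii) $\big(\mathrm{trace}(Y^{(ij)})\big)_{i,j=1}^n=I_n$; (iii) $\mathrm{trace}(YF^TF)=2n$; (iv) $Y-\frac{1}{n^2}J_{n^2}\succeq 0$. In the supremum, instances with $\mathrm{OPT}_{\mathrm{TSP}}(D)=0$ are disregarded, and a ratio with positive numerator and zero denominator is read as $+\infty$. *)

(* Defs.v *)
From HB Require Import structures.
From mathcomp Require Import all_boot all_order all_algebra all_fingroup.
From mathcomp Require Import mxtens ring lra.
From mathcomp Require Import all_classical all_reals all_analysis.

Set Implicit Arguments.
Unset Strict Implicit.
Unset Printing Implicit Defensive.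

Import Order.TTheory GRing.Theory Num.Theory numFieldNormedType.Exports.

Local Open Scope ring_scope.
Local Open Scope classical_set_scope.

Section TSP.
Context {R : realType} {n : nat}.
Implicit Types D : 'M[R]_n.

Definition tsp_instance D : Prop :=
  [/\ forall i j, D i j = D j i,
      forall i j, 0 <= D i j,
      forall i, D i i = 0 &
      forall i j k, D i j <= D i k + D k j].

(* A Hamiltonian cycle of K_n is given by an order of visit s 0, ..., s (n-1)
   of the vertices; ordS is the cyclic successor on 'I_n. *)
Definition tour_cost D (s : 'S_n) : R := \sum_(i < n) D (s i) (s (ordS i)).

Definition OPT_TSP D : R :=
  \big[Num.min/tour_cost D 1%g]_(s : 'S_n) tour_cost D s.

End TSP.

Definition psdmx {R : realType} {m : nat} (A : 'M[R]_m) : Prop :=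
  A^T = A /\ forall x : 'cV[R]_m, 0 <= (x^T *m A *m x) 0 0.

Section SDPA.
Context {R : realType} {n : nat}.

Definition cycle_mx : 'M[R]_n :=
  \matrix_(i, j) ((ordS i == j) || (ordS j == i))%:R.

(* Rows and columns of Y are indexed by pairs through the same bijection
   mxtens_index as the Kronecker product *t, so block (i, j) of A *t B is
   A i j *: B. *)
Definition blockmx (Y : 'M[R]_(n * n)) (i j : 'I_n) : 'M[R]_n :=
  \matrix_(k, l) Y (mxtens_index (i, k)) (mxtens_index (j, l)).

Definition sdpA_F : 'M[R]_(1 * n + n * 1, n * n) :=
  col_mx ((const_mx 1 : 'rV[R]_n) *t (1%:M : 'M[R]_n))
         ((1%:M : 'M[R]_n) *t (const_mx 1 : 'rV[R]_n)).

Definition sdpA_feasible (Y : 'M[R]_(n * n)) : Prop :=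
  [/\ Y^T = Y, forall a b, 0 <= Y a b &
  [/\ \sum_(i < n) blockmx Y i i = 1%:M,
      \matrix_(i < n, j < n) \tr (blockmx Y i j) = 1%:M,
      \tr (Y *m (sdpA_F^T *m sdpA_F)) = (2 * n)%N%:R &
      psdmx (Y - const_mx ((n ^ 2)%N%:R^-1))]].

Definition sdpA_obj (D : 'M[R]_n) (Y : 'M[R]_(n * n)) : R :=
  2^-1 * \tr ((D *t cycle_mx) *m Y).

(* The infimum is a minimum, see OPT_SDPA_min.  In \bar R, 0^-1 = +oo, so the
   ratio x%:E / OPT_SDPA D is +oo when 0 < x and OPT_SDPA D = 0. *)
Definition OPT_SDPA (D : 'M[R]_n) : \bar R :=
  ereal_inf [set (sdpA_obj D Y)%:E | Y in sdpA_feasible].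

End SDPA.

Section Attained.
Context {R : realType} {n : nat}.
Local Notation pair i k := (mxtens_index (i : 'I_n, k : 'I_n)).

Lemma sum_pair (F : 'I_(n * n) -> R) :
  \sum_a F a = \sum_i \sum_k F (pair i k).
Proof.
rewrite pair_bigA /= (reindex (@mxtens_index n n)) /=.
  by apply: eq_bigr => -[].
by exists (@mxtens_unindex n n) => a _; rewrite ?mxtens_indexK ?mxtens_unindexK.
Qed.

Lemma sdpA_F_gram i k j l :
  ((@sdpA_F R n)^T *m sdpA_F) (pair i k) (pair j l) = (k == l)%:R + (i == j)%:R.
Proof.
rewrite /sdpA_F tr_col_mx mul_row_col !trmx_tens !tensmx_mul.
rewrite !trmx1 !trmx_const !mulmx1 !mxE !mxtens_indexK /= !big_ord1 !mxE.
by rewrite !mulr1 mul1r.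
Qed.

Lemma psdmx_entry_le m (A : 'M[R]_m) a b : psdmx A ->
  A a b + A b a <= A a a + A b b.
Proof.
move=> [_ /(_ (delta_mx a 0 - delta_mx b 0))].
rewrite [(_ - _)^T]linearB /= !trmx_delta mulmxBl mulmxBr !mulmxBl -!rowE.
by rewrite -!colE !mxE; lra.
Qed.

Lemma sdpA_entry_le1 (Y : 'M[R]_(n * n)) a b : sdpA_feasible Y -> Y a b <= 1.
Proof.
move=> [sY Y0 [dY _ _ pY]].
have diag c : Y c c <= 1.
  case: (mxtens_indexP c) => i k.
  have := congr1 (fun M : 'M[R]_n => M k k) dY; rewrite summxE !mxE eqxx mulr1n => <-.
  rewrite (bigD1 i) //= mxE lerDl sumr_ge0 // => j _.
  by rewrite mxE Y0.
have := psdmx_entry_le a b pY; rewrite !mxE.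
have -> : Y b a = Y a b by rewrite -[in LHS]sY mxE.
by have := diag a; have := diag b; lra.
Qed.

Lemma quadE m (A : 'M[R]_m) (x : 'cV[R]_m) :
  (x^T *m A *m x) 0 0 = \sum_b \sum_a x a 0 * A a b * x b 0.
Proof.
rewrite mxE; apply: eq_bigr => b _; rewrite mxE mulr_suml.
by apply: eq_bigr => a _; rewrite mxE.
Qed.


Lemma scalar_continuous m (f : 'rV[R]_m -> R) : scalar f -> continuous f.
Proof.
move=> lf; pose g : {scalar 'rV[R]_m} := HB.pack f (GRing.isLinear.Build _ _ _ _ f lf).
have -> : f = \sum_(j < m) (fun v => v 0 j * g (delta_mx 0 j)).
  apply/funext => v; rewrite fct_sumE -[LHS]/(g v) {1}[v]row_sum_delta linear_sum.
  by apply: eq_bigr => j _; rewrite linearZ.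
elim/big_ind: _ => [|h1 h2 c1 c2|j _] v.
- exact: (@cst_continuous _ _ (0 : R) v).
- exact: (cvgD (c1 v) (c2 v)).
- exact: (cvgM (@coord_continuous R _ _ 0 j v) (cvg_cst _)).
Qed.

Lemma scalar_closed_ge m (f : 'rV[R]_m -> R) c : scalar f ->
  closed [set v | c <= f v].
Proof.
move=> /scalar_continuous cf; apply: (preimage_closed _ (@closed_ge _ c)) => v _.
exact: cf.
Qed.

Lemma scalar_closed_eq m (f : 'rV[R]_m -> R) c : scalar f ->
  closed [set v | f v = c].
Proof.
move=> /scalar_continuous cf; apply: (preimage_closed _ (@closed_eq _ c)) => v _.
exact: cf.
Qed.

Lemma closed_forall (T : topologicalType) I (P : I -> T -> Prop) :
  (forall i, closed [set v | P i v]) -> closed [set v | forall i, P i v].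
Proof.
move=> cP; rewrite (_ : mkset _ = \bigcap_i [set v | P i v]).
  by apply: closed_bigI => i _.
by apply/seteqP; split=> v /= h i; [move=> _|]; exact: h.
Qed.

Lemma sdpA_feasibleE (Y : 'M[R]_(n * n)) : sdpA_feasible Y <->
  (((forall a b, Y a b - Y b a = 0) /\ (forall a b, 0 <= Y a b)) /\
   ((forall k l, \sum_i Y (pair i k) (pair i l) = (k == l)%:R) /\
    (forall i j, \sum_k Y (pair i k) (pair j k) = (i == j)%:R))) /\
  (\tr (Y *m (sdpA_F^T *m sdpA_F)) = (2 * n)%N%:R /\
   (forall x : 'cV_(n * n),
     (x^T *m const_mx ((n ^ 2)%N%:R^-1) *m x) 0 0 <= (x^T *m Y *m x) 0 0)).
Proof.
have quadB (x : 'cV[R]_(n * n)) (A B : 'M[R]_(n * n)) :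
    (x^T *m (A - B) *m x) 0 0 = (x^T *m A *m x) 0 0 - (x^T *m B *m x) 0 0.
  by rewrite mulmxBr mulmxBl !mxE.
split=> [[sY Y0 [dY tY FY [_ pY]]]|[[[sY Y0] [dY tY]] [FY pY]]].
- split; split=> //.
  + by split=> // a b; rewrite -[in Y b a]sY mxE subrr.
  + split=> [k l|i j].
      have := congr1 (fun M : 'M[R]_n => M k l) dY; rewrite summxE !mxE => <-.
      by apply: eq_bigr => i _; rewrite mxE.
    have := congr1 (fun M : 'M[R]_n => M i j) tY; rewrite !mxE => <-.
    by apply: eq_bigr => k _; rewrite mxE.
  + by move=> x; have := pY x; rewrite quadB subr_ge0.
- have sY' : Y^T = Y by apply/matrixP => a b; rewrite mxE; have := sY a b; lra.
  split=> //; split=> //.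
  + apply/matrixP => k l; rewrite summxE mxE -[RHS]dY.
    by apply: eq_bigr => i _; rewrite mxE.
  + apply/matrixP => i j; rewrite !mxE -[RHS]tY.
    by apply: eq_bigr => k _; rewrite mxE.
  + split; first by rewrite [LHS]linearB /= sY' trmx_const.
    by move=> x; rewrite quadB subr_ge0.
Qed.

Lemma scalar_sum_entries m (f g : 'I_m -> 'I_(n * n)) :
  scalar (fun v : 'rV[R]_(n * n * (n * n)) => \sum_i vec_mx v (f i) (g i)).
Proof.
move=> c u v /=; rewrite mulr_sumr -big_split; apply: eq_bigr => i _.
by rewrite linearP !mxE.
Qed.

Lemma sdpA_compact :
  compact [set v : 'rV[R]_(n * n * (n * n)) | sdpA_feasible (vec_mx v)].
Proof.
have cl : closed [set v : 'rV[R]_(n * n * (n * n)) | sdpA_feasible (vec_mx v)].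
  under eq_set do rewrite (propext (sdpA_feasibleE _)).
  apply: closedI; [apply: closedI; apply: closedI|apply: closedI].
  - apply: closed_forall => a; apply: closed_forall => b.
    by apply: scalar_closed_eq => c u v; rewrite linearP !mxE /=; ring.
  - apply: closed_forall => a; apply: closed_forall => b.
    by apply: scalar_closed_ge => c u v; rewrite linearP !mxE.
  - apply: closed_forall => k; apply: closed_forall => l.
    by apply: scalar_closed_eq; exact: scalar_sum_entries.
  - apply: closed_forall => k; apply: closed_forall => l.
    by apply: scalar_closed_eq; exact: scalar_sum_entries.
  - apply: scalar_closed_eq => c u v.
    by rewrite linearP /= mulmxDl -scalemxAl linearP.
  - apply: closed_forall => x; apply: scalar_closed_ge => c u v.
    by rewrite linearP /= mulmxDr mulmxDl -scalemxAr -scalemxAl !mxE.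
have cpt := @rV_compact R (n * n * (n * n)) (fun=> `[0, 1]) (fun=> @segment_compact R 0 1).
apply: subclosed_compact cl cpt _ => v /= fv ab.
case/mxvec_indexP: ab => a b; rewrite in_itv /=.
have -> : v ord0 (mxvec_index a b) = vec_mx v a b by rewrite mxE.
by rewrite (sdpA_entry_le1 _ _ fv) andbT; case: fv.
Qed.

End Attained.

Lemma sum_delta (R : realType) (I : finType) (F : I -> R) k :
  \sum_l F l * (l == k)%:R = F k.
Proof.
rewrite (bigD1 k) //= eqxx mulr1 big1 ?addr0 // => l /negbTE ->.
by rewrite mulr0.
Qed.

Lemma sdpA_feasible_neq0 (R : realType) n : (0 < n)%N ->
  exists Y : 'M[R]_(n * n), sdpA_feasible Y.
Proof.
case: n => // m _; set n := m.+1.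
have n0 : n%:R != 0 :> R by rewrite pnatr_eq0.
pose d (a : 'I_(n * n)) : 'I_n :=
  (mxtens_unindex a).2 - (mxtens_unindex a).1.
have dE i k : d (mxtens_index (i, k)) = k - i by rewrite /d mxtens_indexK.
have s1 (k : 'I_n) i : \sum_(l < n) (k - i == l - i)%:R = 1 :> R.
  rewrite -[RHS](sum_delta (fun=> 1) k); apply: eq_bigr => l _.
  by rewrite mul1r (inj_eq (addIr _)) eq_sym.
have s2 (k : 'I_n) i : \sum_(j < n) (k - i == k - j)%:R = 1 :> R.
  rewrite -[RHS](sum_delta (fun=> 1) i); apply: eq_bigr => l _.
  by rewrite mul1r (inj_eq (addrI _)) (inj_eq oppr_inj) eq_sym.
exists (\matrix_(a, b) (n%:R^-1 * (d a == d b)%:R)).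
apply/sdpA_feasibleE; split; [split; split|split].
- by move=> a b; rewrite !mxE eq_sym subrr.
- by move=> a b; rewrite !mxE mulr_ge0 ?invr_ge0 ?ler0n.
- move=> k l; under eq_bigr do rewrite mxE !dE (inj_eq (addIr _)).
  by rewrite sumr_const card_ord -[LHS]mulr_natl mulrA mulfV ?mul1r.
- move=> i j.
  under eq_bigr do rewrite mxE !dE (inj_eq (addrI _)) (inj_eq oppr_inj).
  by rewrite sumr_const card_ord -[LHS]mulr_natl mulrA mulfV ?mul1r.
- rewrite /mxtrace sum_pair.
  transitivity (\sum_(i < n) \sum_(k < n) (2 * n%:R^-1) : R).
    apply: eq_bigr => i _; apply: eq_bigr => k _.
    rewrite mxE sum_pair.
    transitivity (\sum_(j < n) \sum_(l < n) (n%:R^-1 * (k - i == l - j)%:R * (l == k)%:R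
       + n%:R^-1 * (k - i == l - j)%:R * (j == i)%:R) : R).
      apply: eq_bigr => j _; apply: eq_bigr => l _.
      by rewrite sdpA_F_gram mxE !dE mulrDr.
    under eq_bigr do rewrite big_split /= sum_delta -mulr_suml.
    rewrite big_split /= sum_delta -!mulr_sumr s1 s2; ring.
  rewrite !sumr_const !card_ord -!mulrnA -[LHS]mulr_natr !natrM.
  by field.
- move=> x; rewrite !quadE.
  pose S s := \sum_a x a 0 * (d a == s)%:R; pose T := \sum_a x a 0.
  have ST : \sum_s S s = T.
    rewrite exchange_big /=; apply: eq_bigr => a _.
    by under eq_bigr do rewrite eq_sym; rewrite (sum_delta (fun=> x a 0)).
  have -> : \sum_b \sum_a x a 0 * (const_mx ((n ^ 2)%N%:R^-1) : 'M[R]__) a b * x b 0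
    = (n ^ 2)%N%:R^-1 * T ^+ 2.
    rewrite expr2 mulr_sumr mulr_sumr; apply: eq_bigr => b _.
    rewrite mulr_suml mulr_sumr; apply: eq_bigr => a _.
    by rewrite mxE; ring.
  have -> : \sum_b \sum_a x a 0 *
      (\matrix_(a, b) (n%:R^-1 * (d a == d b)%:R) : 'M[R]__) a b * x b 0
    = n%:R^-1 * \sum_s S s ^+ 2.
    transitivity (\sum_b \sum_a \sum_s n%:R^-1 *
        (x a 0 * (d a == s)%:R * (x b 0 * (d b == s)%:R))).
      apply: eq_bigr => b _; apply: eq_bigr => a _.
      rewrite mxE.
      under eq_bigr => s _ do rewrite ![_ * (x b 0 * _)]mulrA mulrA eq_sym [d b == _]eq_sym.
      by rewrite sum_delta eq_sym; ring.
    under eq_bigr do rewrite exchange_big /=.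
    rewrite exchange_big /= mulr_sumr; apply: eq_bigr => s _.
    rewrite expr2 /S mulr_sumr mulr_sumr; apply: eq_bigr => b _.
    by rewrite mulr_suml mulr_sumr.
  have : 0 <= n%:R^-1 * \sum_s (S s - n%:R^-1 * T) ^+ 2.
    by rewrite mulr_ge0 ?invr_ge0 ?ler0n // sumr_ge0 // => s _; exact: sqr_ge0.
  have -> : \sum_s (S s - n%:R^-1 * T) ^+ 2 =
     \sum_s S s ^+ 2 - n%:R^-1 * T ^+ 2.
    transitivity (\sum_(s < n) (S s ^+ 2 - 2 * (n%:R^-1 * T) * S s
        + (n%:R^-1 * T) ^+ 2)).
      by apply: eq_bigr => s _; ring.
    rewrite big_split sumrB -mulr_sumr ST /= sumr_const card_ord -mulr_natr.
    by field.
  rewrite -subr_ge0 natrX; congr (_ <= _); rewrite mulrBr mulrA; congr (_ - _).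
  by field.
Qed.

Lemma OPT_SDPA_min (R : realType) n (D : 'M[R]_n) : (0 < n)%N ->
  exists2 Y, sdpA_feasible Y &
    OPT_SDPA D = (sdpA_obj D Y)%:E /\
    forall Z, sdpA_feasible Z -> sdpA_obj D Y <= sdpA_obj D Z.
Proof.
move=> /(@sdpA_feasible_neq0 R)[Y0 fY0].
pose f (v : 'rV[R]_(n * n * (n * n))) := sdpA_obj D (vec_mx v).
have cf : continuous f.
  apply: scalar_continuous => c u v.
  by rewrite /f /sdpA_obj linearP /= mulmxDr -scalemxAr linearP /=; ring.
have ne : [set v : 'rV[R]_(n * n * (n * n)) | sdpA_feasible (vec_mx v)] !=set0.
  by exists (mxvec Y0); rewrite /= mxvecK.
have [c + cmin] := compact_EVT_min ne (@sdpA_compact R n) (continuous_subspaceT cf).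
rewrite inE /= => fc; have minc Z : sdpA_feasible Z -> f c <= sdpA_obj D Z.
  by move=> fZ; rewrite -[Z]mxvecK; apply: cmin; rewrite inE /= mxvecK.
exists (vec_mx c) => //; split=> //.
apply/eqP; rewrite eq_le; apply/andP; split.
  by apply: ereal_inf_lbound; exists (vec_mx c).
by apply: le_ereal_inf_tmp => _ [Z fZ <-]; rewrite lee_fin minc.
Qed.

(* Main.v *)
(* Split n = 2 d vertices into two halves, at distance 0 inside a half and 1
   across: every tour crosses, so OPT_TSP >= 1.  Place the positions of the tour
   on the unit circle at the angles pi k / d.  Let Y put, for two
   vertices on opposite sides, mass proportional to 1 - cos of the angle between
   their positions; the mass inside a side is then forced by the assignment
   constraints, and Y is feasible.  Adjacent positions on opposite sides thus get mass
   1 - cos (pi / d) = O(1 / d^2), and the objective is at most pi^2 / d. *)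

Require Import Defs.
From mathcomp Require Import all_boot all_order all_algebra all_fingroup.
From mathcomp Require Import mxtens ring lra.
From mathcomp Require Import all_classical all_reals all_analysis.

Import Order.TTheory GRing.Theory Num.Theory.
Import numFieldNormedType.Exports.

Local Open Scope ring_scope.
Local Open Scope classical_set_scope.
Local Open Scope ereal_scope.

Local Notation pair i k := (mxtens_index (i, k)).

(** * Finite sums and graph Laplacians *)

Lemma sum_antiperiodic (V : zmodType) d (f : nat -> V) :
  (forall k, f (d + k)%N = - f k)%R -> (\sum_(k < d + d) f k = 0)%R.
Proof.
move=> fN; rewrite big_split_ord /= -big_split big1 // => k _.
by rewrite /= fN subrr.
Qed.

(** For a weighted graph [w] with all degrees [c], this is the Laplacian identity x^T L x = 1/2 sum
    w_ij (x_i - x_j)^2, with an arbitrary [b i j] in place of x_i x_j so that [b] can itself be a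
    quadratic form. *)
Lemma sum_laplacian (R : numFieldType) (I : finType) (w b : I -> I -> R) (c : R) :
  (forall i j, w i j = w j i) -> (forall i, \sum_j w i j = c)%R ->
  (\sum_i \sum_j (c * (i == j)%:R - w i j) * b i j =
   2^-1 * \sum_i \sum_j w i j * (b i i + b j j - b i j - b j i))%R.
Proof.
move=> wC wc; set S := (\sum_i \sum_j w i j * b i j)%R.
have wr : (\sum_i \sum_j w i j * b i i = c * \sum_i b i i)%R.
  by rewrite mulr_sumr; apply: eq_bigr => i _; rewrite -mulr_suml wc.
have wl : (\sum_i \sum_j w i j * b j j = c * \sum_i b i i)%R.
  rewrite exchange_big -wr; apply: eq_bigr => i _.
  by apply: eq_bigr => j _; rewrite wC.
have St : (\sum_i \sum_j w i j * b j i = S)%R.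
  by rewrite exchange_big; apply: eq_bigr => i _; apply: eq_bigr => j _; rewrite wC.
transitivity (c * \sum_i b i i - S)%R.
  rewrite mulr_sumr -sumrB; apply: eq_bigr => i _.
  under eq_bigr do rewrite mulrBl.
  rewrite sumrB; congr (_ - _)%R.
  rewrite (bigD1 i) //= eqxx mulr1 big1 ?addr0 // => j /negbTE.
  by rewrite eq_sym => ->; rewrite mulr0 mul0r.
under [X in _ = (_ * X)%R]eq_bigr do
  (under eq_bigr do rewrite mulrBr mulrBr mulrDr; rewrite !sumrB big_split /=).
rewrite !sumrB big_split /= wr wl St -/S; by field.
Qed.

(** A Kronecker product of two Laplacians is positive semidefinite: [sum_laplacian] on the first
    factor leaves the second form evaluated at the differences [x i - x j], and on the second factor
    it leaves a weighted sum of squares. *)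
Lemma sum_laplacian2_ge0 (R : realFieldType) (I J : finType)
    (w : I -> I -> R) (v : J -> J -> R) (c e : R) (x : I -> J -> R) :
  (forall i j, w i j = w j i) -> (forall i, \sum_j w i j = c)%R ->
  (forall i j, 0 <= w i j)%R ->
  (forall k l, v k l = v l k) -> (forall k, \sum_l v k l = e)%R ->
  (forall k l, 0 <= v k l)%R ->
  (0 <= \sum_i \sum_j (c * (i == j)%:R - w i j) *
     (\sum_k \sum_l (e * (k == l)%:R - v k l) * (x i k * x j l)))%R.
Proof.
move=> wC wc w0 vC ve v0; rewrite sum_laplacian //.
rewrite mulr_ge0 ?invr_ge0 // sumr_ge0 // => i _; rewrite sumr_ge0 // => j _.
rewrite mulr_ge0 // -big_split -!sumrB /=.
under eq_bigr do rewrite -big_split -!sumrB /=.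
rewrite (_ : (\sum_k _)%R = \sum_k \sum_l (e * (k == l)%:R - v k l) *
    ((x i k - x j k) * (x i l - x j l)))%R; last first.
  by apply: eq_bigr => k _; apply: eq_bigr => l _; ring.
rewrite (@sum_laplacian _ _ _ (fun k l => (x i k - x j k) * (x i l - x j l))%R) //.
rewrite mulr_ge0 ?invr_ge0 // sumr_ge0 // => k _; rewrite sumr_ge0 // => l _.
rewrite mulr_ge0 //; set y := (x i k - _)%R; set z := (x i l - _)%R.
by rewrite (_ : _ - _ = (y - z) ^+ 2)%R ?sqr_ge0 //; ring.
Qed.

Lemma sum_rank1 (R : comPzRingType) (I J : finType) (f : I -> J -> R) :
  (\sum_i \sum_k \sum_j \sum_l f i k * f j l =
   (\sum_i \sum_k f i k) ^+ 2)%R.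
Proof.
rewrite expr2 mulr_suml; apply: eq_bigr => i _.
rewrite mulr_suml; apply: eq_bigr => k _.
rewrite mulr_sumr; apply: eq_bigr => j _.
by rewrite mulr_sumr.
Qed.

Lemma sum4_lincomb (R : pzRingType) (I : finType) (a b c : R) (f g h : I -> I -> I -> I -> R) :
  (\sum_i \sum_k \sum_j \sum_l
     (a * f i k j l + b * g i k j l + c * h i k j l) =
   a * (\sum_i \sum_k \sum_j \sum_l f i k j l)
   + b * (\sum_i \sum_k \sum_j \sum_l g i k j l)
   + c * (\sum_i \sum_k \sum_j \sum_l h i k j l))%R.
Proof.
by do 4!(rewrite !mulr_sumr -!big_split; apply: eq_bigr => ? _ /=).
Qed.

(** By the half-angle formula 1 - cos t = 2 sin^2(t/2); the mean value theorem bounds sin^2 y by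
    y^2. *)
Lemma one_sub_cos_le (R : realType) (t : R) : (1 - cos t <= 2^-1 * t ^+ 2)%R.
Proof.
have sin_le y : (0 <= y -> sin y ^+ 2 <= y ^+ 2 :> R)%R.
  rewrite le_eqVlt => /predU1P[<-|y0]; first by rewrite sin0.
  have [|c _] := @MVT R sin cos 0 y y0 (fun x _ => is_derive_sin x).
    exact: continuous_subspaceT (@continuous_sin R).
  by rewrite sin0 !subr0 => ->; rewrite exprMn ler_piMl ?sqr_ge0.
have half (y : R) : (1 - cos (y *+ 2) = 2 * sin y ^+ 2)%R.
  by rewrite cos_mulr2n sin2cos2; ring.
have -> : cos t = cos ((`|t| / 2) *+ 2)%R.
  by rewrite -[((_ / _) *+ _)%R]mulr_natr mulfVK ?pnatr_eq0 // cos_norm.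
have -> : (2^-1 * t ^+ 2 = 2 * (`|t| / 2) ^+ 2)%R.
  by rewrite expr_div_n real_normK ?num_real //; field.
by rewrite half ler_pM2l // sin_le // divr_ge0.
Qed.

(** * The two-halves instance and its tours *)

Section CutInstance.
Context {R : realType} (d : nat).
Local Notation n := (d + d)%N.

Definition cut_side (i : nat) : bool := (i < d)%N.

Definition cut_mx : 'M[R]_n := \matrix_(i, j) (cut_side i != cut_side j)%:R.

Lemma cut_mx_tsp : tsp_instance cut_mx.
Proof.
split=> [i j|i j|i|i j k]; rewrite !mxE.
- by rewrite eq_sym.
- exact: ler0n.
- by rewrite eqxx.
- rewrite -natrD ler_nat.
  by case: (cut_side i); case: (cut_side j); case: (cut_side k).
Qed.

Lemma cut_mx_tour_ge1 (s : 'S_n) : (0 < d)%N -> (1 <= tour_cost cut_mx s)%R.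
Proof.
move=> d0; have [i Di] : exists i, cut_side (s i) != cut_side (s (ordS i)).
  apply/existsP; apply: contraT => /existsPn side_eq.
  have n0 : (0 < n)%N by rewrite addn_gt0 d0.
  have const k (kn : (k < n)%N) :
      cut_side (s (Ordinal kn)) = cut_side (s (Ordinal n0)).
    (* Without a crossing edge the side is constant along the tour, hence on all vertices, although
       vertices 0 and [d] lie on different sides. *)
    elim: k kn => [|k IH] kn; first by congr (cut_side (s _)); apply: val_inj.
    have kn' := ltnW kn; rewrite -(IH kn').
    have /negPn/eqP -> := side_eq (Ordinal kn').
    by congr (cut_side (s _)); apply: val_inj; rewrite /= modn_small.
  have all_eq (i : 'I_n) : cut_side i = cut_side (s (Ordinal n0)).
    by rewrite -[i](permKV s); case: (perm.perm_inv s i) => k kn; rewrite const.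
  have dn : (d < n)%N by rewrite -addn1 leq_add2l.
  have := all_eq (Ordinal n0); rewrite -(all_eq (Ordinal dn)).
  by rewrite /cut_side /= ltnn d0.
rewrite /tour_cost (bigD1 i) //= mxE Di lerDl sumr_ge0 // => j _.
by rewrite mxE ler0n.
Qed.

Lemma OPT_TSP_cut_mx_ge1 : (0 < d)%N -> (1 <= OPT_TSP cut_mx)%R.
Proof.
move=> d0; rewrite /OPT_TSP; elim/big_ind: _ => [|x y x1 y1|s _].
- exact: cut_mx_tour_ge1.
- by rewrite le_min x1.
- exact: cut_mx_tour_ge1.
Qed.

(** * The candidate SDP solution *)

Definition same_side (i j : 'I_n) : R := (cut_side i == cut_side j)%:R.

Definition cos_kernel (k l : nat) : R :=
  cos (pi * k%:R / d%:R - pi * l%:R / d%:R).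

Local Notation W := same_side.
Local Notation K := cos_kernel.

(** The three terms treat equal vertices, distinct vertices on one side, and vertices on opposite
    sides. A vertex has [d - 1] others on its side and [d = n / 2] opposite, so the divisors make
    the sum over [j] equal to 1/n for all [i], [k], [l]. For [k = l] the last two terms vanish:
    distinct vertices never share a position. *)
Definition cut_sol_entry (i k j l : 'I_n) : R :=
  (n%:R^-1 * ((i == j)%:R * (k == l)%:R
     + (W i j - (i == j)%:R) * ((1 + K k l) / 2 - (k == l)%:R) / (d%:R - 1)
     + (1 - W i j) * (1 - K k l) / n%:R))%R.

Definition cut_sol : 'M[R]_(n * n) :=
  \matrix_(a, b)
    cut_sol_entry (mxtens_unindex a).1 (mxtens_unindex a).2
                  (mxtens_unindex b).1 (mxtens_unindex b).2.

Lemma cut_solE i k j l :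
  cut_sol (pair i k) (pair j l) = cut_sol_entry i k j l.
Proof. by rewrite mxE !mxtens_indexK. Qed.

Lemma same_sideC i j : W i j = W j i.
Proof. by rewrite /W eq_sym. Qed.

Lemma same_side_ge0 i j : (0 <= W i j)%R.
Proof. exact: ler0n. Qed.

Lemma same_side_refl i : W i i = 1%R.
Proof. by rewrite /W eqxx. Qed.

Lemma sum_same_side i : (\sum_j W i j = d%:R)%R.
Proof.
rewrite big_split_ord /=.
under eq_bigr do rewrite /W /cut_side /= ltn_ord.
under [X in (_ + X)%R]eq_bigr do
  rewrite /W /cut_side /= [(d + _ < d)%N]ltnNge leq_addr /=.
by rewrite !sumr_const !card_ord; case: (i < d)%N; rewrite /= mul0rn ?addr0 ?add0r.
Qed.

Lemma cos_kernelC k l : K k l = K l k.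
Proof. by rewrite /K -cosN opprB. Qed.

Lemma cos_kernel_refl k : K k k = 1%R.
Proof. by rewrite /K subrr cos0. Qed.

Lemma cos_kernel_le1 k l : (K k l <= 1)%R.
Proof. exact: cos_le1. Qed.

Lemma cos_kernel_geN1 k l : (-1 <= K k l)%R.
Proof. exact: cos_geN1. Qed.

Lemma cut_sol_entryC i k j l : cut_sol_entry i k j l = cut_sol_entry j l i k.
Proof.
by rewrite /cut_sol_entry same_sideC cos_kernelC [j == i]eq_sym [l == k]eq_sym.
Qed.

Lemma cut_sol_entry_city i k l :
  (cut_sol_entry i k i l = n%:R^-1 * (k == l)%:R)%R.
Proof.
by rewrite /cut_sol_entry same_side_refl eqxx subrr mul1r !mul0r !addr0.
Qed.

Lemma cut_sol_entry_position i j k :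
  (cut_sol_entry i k j k = n%:R^-1 * (i == j)%:R)%R.
Proof.
rewrite /cut_sol_entry cos_kernel_refl eqxx !subrr (_ : (1 + 1) / 2 = 1)%R.
  by rewrite subrr mulr1 !mulr0 !mul0r !addr0.
by field.
Qed.

Context (d_gt1 : (1 < d)%N).

Let d_neq0 : d%:R != 0%R :> R.
Proof. by rewrite pnatr_eq0 -lt0n ltnW. Qed.

Let d1_gt0 : (0 < d%:R - 1 :> R)%R.
Proof. by rewrite subr_gt0 ltr1n. Qed.

Let nE : n%:R = (2 * d%:R)%R :> R.
Proof. by rewrite natrD; ring. Qed.

(** Moving a position by [d] adds pi to its angle and flips the sign of the cosine. Hence the rows
    of (J + K) / n sum to 1, as its Laplacian requires. *)
Lemma sum_cos_kernel k : (\sum_(l < n) K k l = 0)%R.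
Proof.
apply: sum_antiperiodic => l.
rewrite cos_kernelC [in RHS]cos_kernelC /K natrD -cosDpi.
by congr cos; field.
Qed.

Lemma cut_sol_entry_ge0 i k j l : (0 <= cut_sol_entry i k j l)%R.
Proof.
have [-> | ij] := eqVneq i j.
  by rewrite cut_sol_entry_city mulr_ge0 ?invr_ge0.
have [-> | kl] := eqVneq k l.
  by rewrite cut_sol_entry_position mulr_ge0 ?invr_ge0.
(* Off both diagonals the subtracted deltas are 0, and -1 <= K <= 1 suffices. *)
rewrite /cut_sol_entry (negbTE ij) (negbTE kl) !subr0 mul0r add0r.
have := cos_kernel_le1 k l; have := cos_kernel_geN1 k l => K1 KN1.
rewrite mulr_ge0 ?invr_ge0 // addr_ge0 // !mulr_ge0 ?invr_ge0 ?same_side_ge0 //.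
- lra.
- exact: ltW.
- by rewrite subr_ge0 /W lern1 leq_b1.
- lra.
Qed.

(** * Positive semidefiniteness and feasibility *)

Let side_sign (i : 'I_n) : R := ((-1) ^+ cut_side i)%R.
Let angle (k : nat) : R := (pi * k%:R / d%:R)%R.

(* Since 2 W - J is the Gram matrix of side_sign and K that of the unit vectors
   at the angles pi k / d, this writes n (Y - J / n^2) as
   (d I - W) (x) (I - (J + K) / n) / (d - 1) + (2 W - J) (x) K / (2 d),
   the first term being a product of two graph Laplacians. *)
Lemma cut_sol_entry_decomp i k j l :
  (cut_sol_entry i k j l - (n ^ 2)%N%:R^-1 = n%:R^-1 *
    ((d%:R - 1)^-1 * ((d%:R * (i == j)%:R - W i j) *
                      (1 * (k == l)%:R - (1 + K k l) / n%:R))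
     + n%:R^-1 * (side_sign i * cos (angle k) * (side_sign j * cos (angle l)))
     + n%:R^-1 * (side_sign i * sin (angle k) * (side_sign j * sin (angle l)))))%R.
Proof.
have WE : W i j = ((1 + side_sign i * side_sign j) / 2)%R.
  by rewrite /W /side_sign; case: cut_side; case: cut_side;
     rewrite ?expr0 ?expr1 /=; field.
have KE : K k l = (cos (angle k) * cos (angle l) + sin (angle k) * sin (angle l))%R.
  by rewrite /K cosB.
rewrite /cut_sol_entry natrX nE WE KE; field.
by rewrite d_neq0 lt0r_neq0.
Qed.

Lemma cut_sol_quad_ge (x : 'cV[R]_(n * n)) :
  ((x^T *m const_mx ((n ^ 2)%N%:R^-1) *m x) 0 0 <= (x^T *m cut_sol *m x) 0 0)%R.
Proof.
pose y (i k : 'I_n) : R := x (pair i k) 0%R.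
pose lap (i k j l : 'I_n) : R := ((d%:R * (i == j)%:R - W i j) *
  ((1 * (k == l)%:R - (1 + K k l) / n%:R) * (y i k * y j l)))%R.
pose fc (i k : 'I_n) : R := (side_sign i * cos (angle k) * y i k)%R.
pose fs (i k : 'I_n) : R := (side_sign i * sin (angle k) * y i k)%R.
rewrite -subr_ge0 !quadE -sumrB sum_pair.
(* The form splits into a product of Laplacians and two rank-one squares, from the cosine and sine
   coordinates of the unit vectors. *)
rewrite (_ : (\sum_i _)%R = \sum_i \sum_k \sum_j \sum_l
    ((n%:R^-1 * (d%:R - 1)^-1) * lap i k j l
     + n%:R^-2 * (fc i k * fc j l) + n%:R^-2 * (fs i k * fs j l)))%R; last first.
  apply: eq_bigr => i _; apply: eq_bigr => k _; rewrite -sumrB sum_pair.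
  apply: eq_bigr => j _; apply: eq_bigr => l _.
  rewrite cut_solE cut_sol_entryC mxE -/(y i k) -/(y j l).
  transitivity ((cut_sol_entry i k j l - (n ^ 2)%N%:R^-1) * (y i k * y j l))%R.
    by ring.
  by rewrite cut_sol_entry_decomp /lap /fc /fs -exprVn; ring.
have n_gt0 : (0 < n%:R :> R)%R by rewrite nE mulr_gt0 // ltr0n ltnW.
have sq_ge0 (S : R) : (0 <= n%:R^-2 * S ^+ 2)%R.
  by rewrite mulr_ge0 ?invr_ge0 ?sqr_ge0.
rewrite sum4_lincomb !sum_rank1 2?addr_ge0 //.
rewrite mulr_ge0 // ?mulr_ge0 ?invr_ge0 ?(ltW d1_gt0) //.
rewrite (_ : (\sum_i _)%R = \sum_i \sum_j (d%:R * (i == j)%:R - W i j) *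
    (\sum_(k < n) \sum_(l < n)
      (1 * (k == l)%:R - (1 + K k l) / n%:R) * (y i k * y j l)))%R;
  last first.
  apply: eq_bigr => i _; rewrite exchange_big; apply: eq_bigr => j _.
  by rewrite mulr_sumr; apply: eq_bigr => k _; rewrite mulr_sumr.
apply: (@sum_laplacian2_ge0 _ _ _ W (fun k l : 'I_n => (1 + K k l) / n%:R)%R).
- exact: same_sideC.
- exact: sum_same_side.
- exact: same_side_ge0.
- by move=> k l; rewrite cos_kernelC.
- move=> k; rewrite -mulr_suml big_split /= sum_cos_kernel addr0.
  by rewrite sumr_const card_ord mulfV ?lt0r_neq0.
- move=> k l; rewrite divr_ge0 ?(ltW n_gt0) //.
  by rewrite -lerBlDl sub0r cos_kernel_geN1.
Qed.

Lemma cut_sol_feasible : sdpA_feasible cut_sol.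
Proof.
have n_neq0 : n%:R != 0%R :> R by rewrite nE mulf_neq0.
have n1 : ((n%:R^-1 : R) *+ n = 1)%R by rewrite -[LHS]mulr_natl mulfV.
have delta_sum (i : 'I_n) : (\sum_j n%:R^-1 * (i == j)%:R = n%:R^-1 :> R)%R.
  by under eq_bigr do rewrite eq_sym; rewrite (sum_delta (fun=> n%:R^-1)%R).
apply/sdpA_feasibleE; split; [split; split|split].
- move=> a b; case: (mxtens_indexP a) => i k; case: (mxtens_indexP b) => j l.
  by rewrite !cut_solE cut_sol_entryC subrr.
- move=> a b; rewrite mxE; exact: cut_sol_entry_ge0.
- move=> k l; under eq_bigr do rewrite cut_solE cut_sol_entry_city.
  by rewrite sumr_const card_ord -mulrnAl n1 mul1r.
- move=> i j; under eq_bigr do rewrite cut_solE cut_sol_entry_position.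
  by rewrite sumr_const card_ord -mulrnAl n1 mul1r.
- rewrite /mxtrace sum_pair.
  (* Each of the n^2 pairs contributes 1/n from equal positions and 1/n from equal vertices, which
     gives 2n. *)
  transitivity (\sum_(i < n) \sum_(k < n) (n%:R^-1 *+ 2) : R)%R.
    apply: eq_bigr => i _; apply: eq_bigr => k _; rewrite mxE sum_pair.
    transitivity (\sum_(j < n) \sum_(l < n) (cut_sol_entry i k j l * (l == k)%:R
        + cut_sol_entry i k j l * (j == i)%:R))%R.
      apply: eq_bigr => j _; apply: eq_bigr => l _.
      by rewrite cut_solE sdpA_F_gram mulrDr.
    under eq_bigr do rewrite big_split /= sum_delta cut_sol_entry_position.
    rewrite big_split /= exchange_big /=.
    under [X in (_ + X)%R]eq_bigr do rewrite sum_delta cut_sol_entry_city.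
    by rewrite !delta_sum.
  by rewrite !sumr_const !card_ord [(_ *+ 2 *+ n)%R]mulrnAC n1 -mulrnA.
- exact: cut_sol_quad_ge.
Qed.

(** * The objective value *)

Lemma cos_kernel_ordS (k : 'I_n) : K k (ordS k) = cos (pi / d%:R)%R.
Proof.
rewrite /K /=; have [kn|] := ltnP k.+1 n.
  rewrite modn_small // -cosN -natr1; congr cos; field.
  exact: d_neq0.
move=> nk; have {nk} nk : k.+1 = n by apply/eqP; rewrite eqn_leq ltn_ord.
(* Wrap-around: the last position has angle 2 pi - pi/d and its successor has angle 0. *)
rewrite nk modnn mulr0 mul0r subr0 -cosN.
have -> : (k%:R = 2 * d%:R - 1 :> R)%R.
  by have := congr1 (fun m => m%:R : R) nk; rewrite nE -natr1 => <-; ring.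
by rewrite -cosD2pi; congr cos; field.
Qed.

Lemma cut_sol_obj_le : (sdpA_obj cut_mx cut_sol <= pi ^+ 2 / d%:R)%R.
Proof.
set q := (1 - cos (pi / d%:R) : R)%R.
have n_gt0 : (0 < n%:R :> R)%R by rewrite nE mulr_gt0 // ltr0n ltnW.
have row (k : 'I_n) : (\sum_l cycle_mx k l * (1 - K k l) <= 2 * q)%R.
  have le_nbrs : (\sum_l cycle_mx k l * (1 - K k l) <=
      \sum_(l < n) ((1 - K k l) * (l == ordS k)%:R +
                    (1 - K k l) * (l == ord_pred k)%:R))%R.
    apply: ler_sum => l _; rewrite mxE -mulrDr mulrC ler_wpM2l //.
      by rewrite subr_ge0 cos_kernel_le1.
    rewrite -natrD ler_nat eq_sym (can2_eq (@ordSK n) (@ord_predK n)).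
    by case: eqP; case: eqP.
  apply: (le_trans le_nbrs).
  rewrite big_split /= !sum_delta cos_kernel_ordS cos_kernelC.
  by rewrite -{2}[k]ord_predK cos_kernel_ordS -/q -mulr2n mulr_natl.
have term (i k j l : 'I_n) :
    (cut_mx i j * cycle_mx k l * cut_sol_entry j l i k <=
     n%:R^-2 * (cycle_mx k l * (1 - K k l)))%R.
  have C0 : (0 <= cycle_mx k l :> R)%R by rewrite mxE ler0n.
  rewrite mxE; case: eqP => side /=.
    rewrite !mul0r mulr_ge0 ?invr_ge0 ?sqr_ge0 // mulr_ge0 //.
    by rewrite subr_ge0 cos_kernel_le1.
  rewrite cut_sol_entryC /cut_sol_entry.
  have -> : (i == j) = false by apply/eqP => ij; apply: side; rewrite ij.
  have -> : W i j = 0%R by rewrite /W; case: eqP.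
  rewrite /= le_eqVlt; apply/orP; left; apply/eqP; field.
  by rewrite -natrD !lt0r_neq0.
(* There are n^3 triples (i, k, j), each bounded by 2q/n^2, and the objective has a factor 1/2.
   Counting every [j], not only the opposite half, costs a factor of 2. *)
have obj : (sdpA_obj cut_mx cut_sol <= n%:R * q)%R.
  rewrite /sdpA_obj ler_pdivrMl // /mxtrace sum_pair.
  apply: (@le_trans _ _ (\sum_(i < n) \sum_(k < n) \sum_(j < n)
                          n%:R^-2 * (2 * q)))%R.
    apply: ler_sum => i _; apply: ler_sum => k _; rewrite mxE sum_pair.
    apply: ler_sum => j _.
    apply: (@le_trans _ _ (\sum_(l < n) n%:R^-2 * (cycle_mx k l * (1 - K k l))))%R.
      apply: ler_sum => l _; rewrite tensmxE cut_solE; exact: term.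
    by rewrite -mulr_sumr ler_wpM2l // invr_ge0 sqr_ge0.
  rewrite !sumr_const !card_ord -!mulrnA -[leLHS]mulr_natr !natrM.
  rewrite le_eqVlt; apply/orP; left; apply/eqP; field.
  by rewrite -natrD lt0r_neq0.
apply: (le_trans obj); rewrite nE.
apply: (@le_trans _ _ (2 * d%:R * (2^-1 * (pi / d%:R) ^+ 2)))%R.
  by rewrite ler_wpM2l ?mulr_ge0 // one_sub_cos_le.
by rewrite le_eqVlt; apply/orP; left; apply/eqP; field.
Qed.

End CutInstance.

(** * The unbounded ratio *)

Lemma sdpA_obj_ge0 (R : realType) n (D : 'M[R]_n) (X : 'M[R]_(n * n)) :
  tsp_instance D -> sdpA_feasible X -> (0 <= sdpA_obj D X)%R.
Proof.
move=> [_ D0 _ _] [_ X0 _]; rewrite mulr_ge0 ?invr_ge0 // sumr_ge0 // => a _.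
by rewrite mxE sumr_ge0 // => b _; rewrite mulr_ge0 // !mxE mulr_ge0 // ler0n.
Qed.

Theorem corollary4p23 (R : realType) :
  ereal_sup [set r : \bar R | exists (n : nat) (D : 'M[R]_n),
    [/\ (3 <= n)%N, tsp_instance D, (OPT_TSP D != 0)%R &
        r = (OPT_TSP D)%:E / OPT_SDPA D]] = +oo.
Proof.
apply/eqyP => A A_gt0.
(* One successor gives d >= A pi^2, so that A times the bound pi^2 / d is at most 1 <= [OPT_TSP D];
   the other ensures d > 1. *)
set d := (Num.truncn (A * pi ^+ 2)%R).+2.
have d_large : (A * pi ^+ 2 <= d%:R)%R.
  by rewrite (le_trans (ltW (truncnS_gt _))) // ler_nat.
have d_gt1 : (1 < d)%N by [].
pose D : 'M[R]_(d + d) := cut_mx d.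
have tspD : tsp_instance D := cut_mx_tsp d.
have opt1 : (1 <= OPT_TSP D)%R by rewrite OPT_TSP_cut_mx_ge1.
have opt_gt0 : (0 < OPT_TSP D)%R := lt_le_trans ltr01 opt1.
have [Y feasY [optY minY]] := @OPT_SDPA_min R (d + d) D isT.
have obj_le := le_trans (minY _ (cut_sol_feasible d d_gt1)) (cut_sol_obj_le d d_gt1).
apply: (@le_trans _ _ ((OPT_TSP D)%:E / OPT_SDPA D)); last first.
  by apply: ereal_sup_ubound; exists (d + d)%N, D; split;
     rewrite ?addSn ?addnS ?lt0r_neq0.
(* If the SDP optimum is 0, the ratio is +oo by the convention on inverses. *)
rewrite optY inver; case: eqP => [_|/eqP obj_neq0].
  by rewrite gt0_muley ?lte_fin // leey.
have obj_gt0 : (0 < sdpA_obj D Y)%R by rewrite lt0r obj_neq0 sdpA_obj_ge0.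
rewrite -EFinM lee_fin ler_pdivlMr // (le_trans _ opt1) //.
apply: (le_trans (ler_wpM2l (ltW A_gt0) obj_le)).
by rewrite mulrA ler_pdivrMr ?mul1r // ltr0n.
Qed.
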